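(* Let $\Omega$ be a nonempty finite set. Let $\mathscr P=\mathscr T(M)/\langle R\rangle$ be a unary binary quadratic symmetric operad such that $M(1)$ and $M(2)$ are finite dimensional. Then $$\big(\mathscr P^{\mathrm{LC}}_\Omega\big)^!=\big(\mathscr P^!\big)^{\mathrm{TC}}_\Omega\qquad\text{and}\qquad \big(\mathscr P^{\mathrm{TC}}_\Omega\big)^!=\big(\mathscr P^!\big)^{\mathrm{LC}}_\Omega .$$
   Context: $\mathbf k$ is a field of characteristic zero; operads are symmetric operads of $\mathbf k$-vector spaces, assumed reduced ($\mathscr P(0)=0$). For an $\mathbb S$-module $M$ with basis $X$, the free operad $\mathscr T(M)$ is spanned by decorated trees $(t,d)$: $t$ is a planar rooted tree with leaves labelled by $[n]$, and $d:V(t)\to X$ decorates each internal vertex by a generator of the matching arity (modulo the usual identifications from the symmetric group actions). $\mathscr T(M)^{(m)}$ is spanned by trees with $m$ internal vertices. A unary binary quadratic operad is $\mathscr P=\mathscr T(M)/\langle R\rangle$ with $M$ concentrated in arities 1 and 2 and $R\subseteq\mathscr T(M)^{(2)}$. Compatible operads. For $\omega\in\Omega$ let $M_\omega$ be a copy of $M$ with basis $X_\omega=\{x_\omega\mid x\in X\}$. $C(\Omega,m)$ is the set of maps $c:\Omega\to\mathbb Z_{\ge0}$ with $\sum_\omega c_\omega=m$. For a decorated tree $(t,d)$ with $m$ vertices and $c\in C(\Omega,m)$, $\mathrm{Col}(d,c)$ is the set of decorations $D$ of $t$ obtained by attaching a label $\omega\in\Omega$ to each $d(v)$ (replacing $x$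 by $x_\omega$) so that each $\omega$ is used exactly $c_\omega$ times. Write $r=\sum_{i=0}^s\alpha_i(t_i,d_i)\in R$ with $\alpha_i\ne0$ and distinct $(t_i,d_i)$; here $m=2$. (LC) $\mathscr P^{\mathrm{LC}}_\Omega=\mathscr T(\bigoplus_\omega M_\omega)/\langle r_c\mid r\in R,\ c\in C(\Omega,2)\rangle$, where $r_c=\sum_i\alpha_i\sum_{D\in\mathrm{Col}(d_i,c)}(t_i,D)$. (TC) Let $R_{\mathrm{TC}}=\{(t_i,\delta)-(t_i,\tau)\mid r\in R,\ 0\le i\le s,\ c\in C(\Omega,2),\ \delta,\tau\in\mathrm{Col}(d_i,c)\}$. Let $R_{\mathrm{MT}}$ be a matching compatibility of $R$: for each $r$ and $c$, list $\mathrm{Col}(d_i,c)=\{D_{i,1},\dots,D_{i,b}\}$ with $b=\frac{2!}{\prod_\omega c_\omega!}$, choose permutations $\sigma_1,\dots,\sigma_s\in S_b$, and include the relations $\alpha_0(t_0,D_{0,j})+\sum_{i=1}^s\alpha_i(t_i,D_{i,\sigma_i(j)})$, $1\le j\le b$ (choices being compatible with the symmetric group actions on $R$). Then $\mathscr P^{\mathrm{TC}}_\Omega=\mathscr T(\bigoplus_\omega M_\omega)/\langle R_{\mathrm{MT}}\cup R_{\mathrm{TC}}\rangle$; this does not depend on the choice of $R_{\mathrm{MT}}$. Koszul dual. For a unary binary quadratic operad $\mathscr P=\mathscr T(M)/\langle R\rangle$ with $M$ finite dimensional in each arity, $\mathscr P^!=\mathscr T(M^\vee)/\langle R^\perp\rangle$,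 where $M^\vee=M^*\otimes_{\mathrm H}\mathrm{sgn}$ is the aritywise tensor product of the linear dual with the sign representations, and $R^\perp\subseteq\mathscr T(M^\vee)^{(2)}$ is the orthogonal of $R$. The equalities use the identification $(\bigoplus_\omega M_\omega)^\vee\cong\bigoplus_\omega M_\omega^\vee$.
   Formalization: As stated it fails (M(1)=kx, M(2)=0, R=0, |Ω|≥2). Proved with R_TC taken over all two-vertex decorated trees; for the literal R_TC, each equality is proved assuming, if |Ω|>1, that every two-vertex decorated tree occurs in a relation of the operad to which TC is applied. *)

(* Defs.v *)
From HB Require Import structures.
From mathcomp Require Import all_boot all_order all_algebra all_fingroup.
From mathcomp Require Import finmap.
From mathcomp Require Export monalg.

Set Implicit Arguments.
Unset Strict Implicit.
Unset Printing Implicit Defensive.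

Import GRing.Theory.
Local Open Scope ring_scope.

(* Planar rooted trees with unary vertices decorated by X1, binary vertices   *)
(* decorated by X2, and leaves labelled by natural numbers.                   *)

Inductive tree (X1 X2 : Type) : Type :=
  | Leaf of nat
  | Un of X1 & tree X1 X2
  | Bin of X2 & tree X1 X2 & tree X1 X2.

Arguments Leaf {X1 X2} _.
Arguments Un {X1 X2} _ _.
Arguments Bin {X1 X2} _ _ _.

Section TreeChoice.
Variables X1 X2 : choiceType.

Fixpoint tree_enc (t : tree X1 X2) : GenTree.tree (nat + X1 + X2) :=
  match t with
  | Leaf i => GenTree.Leaf (inl (inl i))
  | Un x u => GenTree.Node 1 [:: GenTree.Leaf (inl (inr x)); tree_enc u]
  | Bin x u v =>
      GenTree.Node 2 [:: GenTree.Leaf (inr x); tree_enc u; tree_enc v]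
  end.

Fixpoint tree_dec (g : GenTree.tree (nat + X1 + X2)) : option (tree X1 X2) :=
  match g with
  | GenTree.Leaf (inl (inl i)) => Some (Leaf i)
  | GenTree.Node _ [:: GenTree.Leaf (inl (inr x)); u] =>
      omap (Un x) (tree_dec u)
  | GenTree.Node _ [:: GenTree.Leaf (inr x); u; v] =>
      if (tree_dec u, tree_dec v) is (Some u', Some v') then Some (Bin x u' v')
      else None
  | _ => None
  end.

Lemma tree_encK : pcancel tree_enc tree_dec.
Proof. by elim=> [i|x u IHu|x u IHu v IHv] //=; rewrite IHu // IHv. Qed.

HB.instance Definition _ := Choice.copy (tree X1 X2) (pcan_type tree_encK).

End TreeChoice.

Section TreeOperations.
Variables X1 X2 : Type.
Implicit Types t u v : tree X1 X2.

Fixpoint leaves t : seq nat :=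
  match t with
  | Leaf i => [:: i]
  | Un _ u => leaves u
  | Bin _ u v => leaves u ++ leaves v
  end.

Fixpoint weight t : nat :=
  match t with
  | Leaf _ => 0
  | Un _ u => (weight u).+1
  | Bin _ u v => (weight u + weight v).+1
  end.

Fixpoint min_leaf t : nat :=
  match t with
  | Leaf i => i
  | Un _ u => min_leaf u
  | Bin _ u v => minn (min_leaf u) (min_leaf v)
  end.

Fixpoint shuffle t : bool :=
  match t with
  | Leaf _ => true
  | Un _ u => shuffle u
  | Bin _ u v => [&& min_leaf u < min_leaf v, shuffle u & shuffle v]%N
  end.

(* Using x(u, v) = (x . (1 2))(v, u), every tree of arity n is a combination  *)
(* of trees in which, at each binary vertex, the left subtree contains the    *)
(* smaller minimal leaf, and these trees form a basis of T(M)(n). Leaves are  *)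
(* labelled from 0 to n - 1.                                                  *)
Definition basis_tree (n : nat) t : bool :=
  shuffle t && perm_eq (leaves t) (iota 0 n).

Fixpoint relabel (f : nat -> nat) t : tree X1 X2 :=
  match t with
  | Leaf i => Leaf (f i)
  | Un x u => Un x (relabel f u)
  | Bin x u v => Bin x (relabel f u) (relabel f v)
  end.

(* Replaces leaf i of t by v; the labels of v are shifted by i and those of   *)
(* t above i by (number of leaves of v) - 1. The relabellings are increasing  *)
(* and the least leaf of the copy of v is i, so basis trees are preserved.    *)
Fixpoint graft (i : nat) t v : tree X1 X2 :=
  match t with
  | Leaf j =>
      if j == i then relabel (addn i) v
      else if (j < i)%N then Leaf j else Leaf (j + size (leaves v)).-1
  | Un x u => Un x (graft i u v)
  | Bin x u u' => Bin x (graft i u v) (graft i u' v)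
  end.

End TreeOperations.

(* An S-module concentrated in arities 1 and 2, finite dimensional in each,   *)
(* given by bases X1 of M(1) and X2 of M(2) and by the matrix of the          *)
(* transposition: x . (1 2) = \sum_y swap x y *: y.                           *)
Record smodule (k : fieldType) (X1 X2 : finType) := SModule {
  swap : X2 -> X2 -> k;
  swapK : forall x z, \sum_y swap x y * swap y z = (x == z)%:R
}.

Arguments SModule {k X1 X2 swap} _.

Section FreeOperad.
Variables (k : fieldType) (X1 X2 : finType).

Notation tree := (tree X1 X2).
Notation vec := {malg k[tree]}.

Definition linext (f : tree -> vec) (p : vec) : vec :=
  \sum_(t <- msupp p) p@_t *: f t.

Definition in_free (n : nat) (p : vec) : Prop :=
  forall t, t \in msupp p -> basis_tree n t.

Definition in_free2 (n : nat) (p : vec) : Prop :=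
  forall t, t \in msupp p -> basis_tree n t && (weight t == 2).

(* The class in T(M) of an arbitrary planar tree. *)
Fixpoint normal_form (M : smodule k X1 X2) (t : tree) : vec :=
  match t with
  | Leaf i => << Leaf i >>
  | Un x u => linext (fun u' => << Un x u' >>) (normal_form M u)
  | Bin x u v =>
      if (min_leaf u < min_leaf v)%N then
        linext (fun u' => linext (fun v' => << Bin x u' v' >>) (normal_form M v))
               (normal_form M u)
      else
        \sum_(y : X2) swap M x y *:
          linext (fun v' => linext (fun u' => << Bin y v' u' >>) (normal_form M u))
                 (normal_form M v)
  end.

Definition perm_label n (s : 'S_n) (j : nat) : nat :=
  if insub j is Some o then s o else j.

Definition act (M : smodule k X1 X2) n (s : 'S_n) (p : vec) : vec :=
  linext (fun t => normal_form M (relabel (perm_label s) t)) p.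

(* Partial composition p o_(i+1) q. *)
Definition pcomp (i : nat) (p q : vec) : vec :=
  linext (fun t => linext (fun u => << graft i t u >>) q) p.

Record is_ideal (M : smodule k X1 X2) (I : nat -> vec -> Prop) : Prop :=
  IsIdeal {
    ideal_free n p : I n p -> in_free n p;
    ideal0 n : I n 0;
    idealP n (a : k) p q : I n p -> I n q -> I n (a *: p + q);
    ideal_act n (s : 'S_n) p : I n p -> I n (act M s p);
    ideal_compl m n i p q : (i < m)%N -> I m p -> in_free n q ->
      I (m + n).-1 (pcomp i p q);
    ideal_compr m n i p q : (i < m)%N -> in_free m p -> I n q ->
      I (m + n).-1 (pcomp i p q)
  }.

Definition ideal_gen (M : smodule k X1 X2) (R : nat -> vec -> Prop)
    (n : nat) (p : vec) : Prop :=
  forall I, is_ideal M I -> (forall m r, R m r -> I m r) -> I n p.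

(* The data (M, R) presenting T(M) / <R>. *)
Record presentation := Presentation {
  gens : smodule k X1 X2;
  rels : nat -> vec -> Prop
}.

Definition quadratic (P : presentation) : Prop :=
  forall n r, rels P n r -> in_free2 n r.

(* T(M) / <R> and T(M') / <R'> are equal, M and M' having the same basis. *)
Definition same_operad (P Q : presentation) : Prop :=
  (forall x y, swap (gens P) x y = swap (gens Q) x y) /\
  (forall n p, ideal_gen (gens P) (rels P) n p
           <-> ideal_gen (gens Q) (rels Q) n p).

(* The dual basis of M^*(2) (x) sgn, with (f . s)(m) = f (m . s^-1). *)
Definition dual_swap (M : smodule k X1 X2) (x y : X2) : k := - swap M y x.

Lemma dual_swapK (M : smodule k X1 X2) x z :
  \sum_y dual_swap M x y * dual_swap M y z = (x == z)%:R.
Proof.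
rewrite eq_sym -(swapK M z x); apply: eq_bigr => y _.
by rewrite /dual_swap mulrNN mulrC.
Qed.

Definition dual (M : smodule k X1 X2) : smodule k X1 X2 :=
  SModule (dual_swapK M).

Fixpoint inversions (s : seq nat) : nat :=
  if s is i :: s' then (count (fun j => j < i)%N s' + inversions s')%N else 0.

(* The pairing of T(M^v)^(2) and T(M)^(2) is diagonal on basis trees. The     *)
(* tree a o_i b, with leaves permuted by s, is paired with its dual with sign *)
(* sgn(s) (-1)^((i - 1)(arity(b) - 1)), so that <f . s, p . s> =              *)
(* sgn(s) <f, p>. For binary a and b this is the pairing of                   *)
(* Ginzburg-Kapranov and Loday-Vallette; only x(i, y(j, l)) has i = 2 and     *)
(* arity(b) = 2.                                                              *)
Definition tree_sign (t : tree) : k :=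
  (-1) ^+ (inversions (leaves t)
           + (if t is Bin _ (Leaf _) (Bin _ _ _) then 1 else 0)).

Definition pairing (f p : vec) : k :=
  \sum_(t <- msupp p) tree_sign t * f@_t * p@_t.

(* The orthogonal of the sub-S-module generated by R; it is the orthogonal of *)
(* R when R is itself a sub-S-module.                                         *)
Definition orthogonal (M : smodule k X1 X2) (R : nat -> vec -> Prop)
    (n : nat) (f : vec) : Prop :=
  in_free2 n f /\ forall r, R n r -> forall s : 'S_n, pairing f (act M s r) = 0.

Definition koszul_dual (P : presentation) : presentation :=
  Presentation (dual (gens P)) (orthogonal (gens P) (rels P)).

(* The decorated tree t occurs in some relation of arity n. *)
Definition occurs (P : presentation) (n : nat) (t : tree) : Prop :=
  exists2 r, rels P n r & t \in msupp r.

Definition every_tree_occurs (P : presentation) : Prop :=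
  forall n t, basis_tree n t -> weight t = 2 -> occurs P n t.

End FreeOperad.

Section Compatible.
Variables (k : fieldType) (X1 X2 Omega : finType).

Notation vec := {malg k[tree X1 X2]}.
Notation ctree := (tree (Omega * X1)%type (Omega * X2)%type).
Notation cvec := {malg k[ctree]}.

(* The sum over w in Omega of copies M_w of M, with basis the x_w = (w, x). *)
Definition copies_swap (M : smodule k X1 X2) (x y : Omega * X2) : k :=
  if x.1 == y.1 then swap M x.2 y.2 else 0.

Lemma copies_swapK (M : smodule k X1 X2) x z :
  \sum_y copies_swap M x y * copies_swap M y z = (x == z)%:R.
Proof.
case: x z => [w x] [v z].
rewrite -(pair_bigA _ (fun u y => copies_swap M (w, x) (u, y)
                                 * copies_swap M (u, y) (v, z))) /=.
rewrite (bigD1 w) //= [X in _ + X]big1 ?addr0 => [|u /negbTE nuw].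
  rewrite /copies_swap /= eqxx xpair_eqE; case: eqP => [_|_] /=.
    exact: swapK.
  by apply: big1 => y _; rewrite mulr0.
by apply: big1 => y _; rewrite /copies_swap /= eq_sym nuw mul0r.
Qed.

Definition copies (M : smodule k X1 X2) :
  smodule k (Omega * X1)%type (Omega * X2)%type := SModule (copies_swapK M).

Fixpoint colours (D : ctree) : seq Omega :=
  match D with
  | Leaf _ => [::]
  | Un x u => x.1 :: colours u
  | Bin x u v => x.1 :: colours u ++ colours v
  end.

Fixpoint colourings (t : tree X1 X2) : seq ctree :=
  match t with
  | Leaf i => [:: Leaf i]
  | Un x u => [seq Un (w, x) u' | w <- enum Omega, u' <- colourings u]
  | Bin x u v =>
      [seq f v' | f <- [seq Bin (w, x) u' | w <- enum Omega, u' <- colourings u],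
                  v' <- colourings v]
  end.

(* C(Omega, 2) *)
Definition content2 (c : {ffun Omega -> nat}) : Prop := (\sum_w c w = 2)%N.

Definition Col (t : tree X1 X2) (c : {ffun Omega -> nat}) : seq ctree :=
  [seq D <- colourings t | [forall w, count_mem w (colours D) == c w]].

Definition polarize (r : vec) (c : {ffun Omega -> nat}) : cvec :=
  \sum_(t <- msupp r) r@_t *: \sum_(D <- Col t c) << D >>.

Inductive LC_rels (P : presentation k X1 X2) (n : nat) : cvec -> Prop :=
  | LCRel r c : rels P n r -> content2 c -> LC_rels P n (polarize r c).

Definition LC (P : presentation k X1 X2) :=
  Presentation (copies (gens P)) (LC_rels P).

(* A choice, for each relation r, each c and each tree t, of a listing        *)
(* D_(t,0), D_(t,1), ... of Col(t, c); the permutations defining a matching   *)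
(* compatibility are the changes of listing from one tree of r to another.    *)
Definition is_listing
    (E : vec -> {ffun Omega -> nat} -> tree X1 X2 -> seq ctree) : Prop :=
  forall r c t, perm_eq (E r c t) (Col t c).

Inductive MT_rels (E : vec -> {ffun Omega -> nat} -> tree X1 X2 -> seq ctree)
    (P : presentation k X1 X2) (n : nat) : cvec -> Prop :=
  | MTRel r c j : rels P n r -> content2 c ->
      (j < 2`! %/ \prod_w (c w)`!)%N ->
      MT_rels E P n
        (\sum_(t <- msupp r) r@_t *: << nth (Leaf 0) (E r c t) j >>).

(* (t, D) - (t, D') for the decorated trees t of arity n with S n t. *)
Inductive TC_rels (S : nat -> tree X1 X2 -> Prop) (n : nat) : cvec -> Prop :=
  | TCRel t c D D' : S n t -> content2 c -> D \in Col t c -> D' \in Col t c ->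
      TC_rels S n (<< D >> - << D' >>).

(* R_TC only involves the decorated trees occurring in some relation, so TC   *)
(* depends on the presentation and on the basis. A decorated tree t that      *)
(* occurs in no relation obstructs duality with LC: t is then a relation of   *)
(* the dual, whose polarization is the sum over Col(t, c), while the dual of  *)
(* TC contains each element of Col(t, c). For instance, let P = k[x] (M(1)    *)
(* spanned by x, M(2) = 0, R = 0) and #|Omega| > 1: TC(P) is free on the x_w, *)
(* so its dual kills every x_v x_w, whereas LC(P^!) is the exterior algebra   *)
(* on the x_w. TCall imposes total compatibility on all the decorated trees   *)
(* with two vertices; it coincides with TC when they all occur in relations.  *)
Definition TC E (P : presentation k X1 X2) :=
  Presentation (copies (gens P))
    (fun n f => MT_rels E P n f \/ TC_rels (occurs P) n f).

Definition TCall E (P : presentation k X1 X2) :=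
  Presentation (copies (gens P))
    (fun n f => MT_rels E P n f \/
       TC_rels (fun m t => basis_tree m t && (weight t == 2)) n f).

End Compatible.

Arguments LC {k X1 X2} Omega P.

(* Main.v *)
(* Forgetting colours, restricted to the decorated trees of colour content c,  *)
(* is adjoint to polarization at c for the pairings, and both maps commute     *)
(* with the symmetric groups. Hence f is orthogonal to the polarizations of R  *)
(* iff each uncoloured f_c lies in R^perp; total compatibility reduces f to a  *)
(* sum of matching relations of the f_c. Dually, orthogonality to the totally  *)
(* compatible relations makes the coefficients of f constant on each Col(t,c), *)
(* so f is a sum of polarizations of the f_c / #|Col(t, c)|, where the number  *)
(* #|Col(t, c)| in {1, 2} does not depend on t; and f_c lies in R^perp because *)
(* the matching relations of r at c add up to its polarization.                *)

Require Import Defs.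
From HB Require Import structures.
From mathcomp Require Import all_boot all_order all_algebra.
From mathcomp Require Import fingroup perm finmap.
(* Restores [act] and [orthogonal], shadowed by notions of MathComp. *)
Import Defs.

Set Implicit Arguments.
Unset Strict Implicit.
Unset Printing Implicit Defensive.

Import GRing.Theory.
Local Open Scope ring_scope.

HB.lock Definition ext (k : fieldType) (T : choiceType) (V : lmodType k)
    (f : T -> V) (p : {malg k[T]}) : V := \sum_(t <- msupp p) p@_t *: f t.

Section LinearExtension.
Variables (k : fieldType) (T : choiceType).
Implicit Types (V W : lmodType k) (p q : {malg k[T]}).

Lemma extE V (f : T -> V) p : ext f p = \sum_(t <- msupp p) p@_t *: f t.
Proof. by rewrite unlock. Qed.

Lemma ext_widen V (f : T -> V) p (d : {fset T}) :
  (msupp p `<=` d)%fset -> ext f p = \sum_(t <- d) p@_t *: f t.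
Proof.
move=> sub; rewrite extE; apply: big_fset_incl => // t _.
by move/mcoeff_outdom ->; rewrite scale0r.
Qed.

Fact ext_is_linear V (f : T -> V) : linear (ext f).
Proof.
move=> a p q; pose d := (msupp p `|` msupp q `|` msupp (a *: p + q))%fset.
rewrite !(@ext_widen _ _ _ d) /d ?fsubsetUr //; first last.
- by rewrite -fsetUA fsubsetUl.
- by rewrite fsetUAC fsubsetUr.
rewrite scaler_sumr -big_split /=; apply: eq_bigr => t _.
by rewrite mcoeffD mcoeffZ scalerDl scalerA.
Qed.

HB.instance Definition _ V (f : T -> V) :=
  GRing.isLinear.Build k {malg k[T]} V *:%R (ext f) (ext_is_linear f).

Lemma extU V (f : T -> V) t : ext f << t >> = f t.
Proof.
by rewrite extE msuppU oner_eq0 big_seq_fset1 mcoeffU eqxx scale1r.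
Qed.

Lemma eq_ext V (f g : T -> V) p : {in msupp p, f =1 g} -> ext f p = ext g p.
Proof. by move=> fg; rewrite !extE; apply: eq_big_seq => t /fg ->. Qed.

Lemma ext_linear V W (h : {linear V -> W}) (f : T -> V) p :
  h (ext f p) = ext (h \o f) p.
Proof.
by rewrite !extE linear_sum; apply: eq_bigr => t _; rewrite linearZ.
Qed.

Lemma extD V (f g : T -> V) p : ext (fun t => f t + g t) p = ext f p + ext g p.
Proof.
by rewrite !extE -big_split; apply: eq_bigr => t _; rewrite scalerDr.
Qed.

Lemma extZ V a (f : T -> V) p : ext (fun t => a *: f t) p = a *: ext f p.
Proof.
by rewrite !extE scaler_sumr; apply: eq_bigr => t _; rewrite !scalerA mulrC.
Qed.

Lemma ext_sum V I (r : seq I) (f : I -> T -> V) p :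
  ext (fun t => \sum_(i <- r) f i t) p = \sum_(i <- r) ext (f i) p.
Proof.
rewrite extE; under eq_bigr => t _ do rewrite scaler_sumr.
under [RHS]eq_bigr => i _ do rewrite extE.
exact: exchange_big.
Qed.

Lemma ext_lincomb V (f : T -> V) I (r : seq I) (a : I -> k)
    (p : I -> {malg k[T]}) :
  ext f (\sum_(i <- r) a i *: p i) = \sum_(i <- r) a i *: ext f (p i).
Proof. by rewrite linear_sum; apply: eq_bigr => i _; rewrite linearZ. Qed.

Lemma ext_sumr V (f : T -> V) I (r : seq I) (p : I -> {malg k[T]}) :
  ext f (\sum_(i <- r) p i) = \sum_(i <- r) ext f (p i).
Proof. exact: linear_sum. Qed.

Lemma ext_scale V (f : T -> V) a p : ext f (a *: p) = a *: ext f p.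
Proof. exact: linearZ. Qed.

Lemma ext_id p : ext (fun t => << t >>) p = p.
Proof.
apply/malgP => t; rewrite extE (raddf_sum (mcoeff t)) /=.
under eq_bigr => u _ do rewrite mcoeffZ mcoeffU.
have [tp|tp] := boolP (t \in msupp p).
  rewrite (big_fsetD1 t) //= eqxx mulr1 big1_fset ?addr0 // => u.
  by rewrite !inE => /andP[/negbTE -> _] _; rewrite mulr0.
rewrite mcoeff_outdom // big1_fset // => u up _.
by case: eqP tp => [<-|_ _]; rewrite ?up ?mulr0.
Qed.

Lemma mcoeff_ext (S : choiceType) (f : T -> {malg k[S]}) p s :
  (ext f p)@_s = \sum_(t <- msupp p) p@_t * (f t)@_s.
Proof.
rewrite extE (raddf_sum (mcoeff s)).
by apply: eq_bigr => t _; rewrite /= mcoeffZ.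
Qed.

Lemma msupp_ext (S : choiceType) (f : T -> {malg k[S]}) p s :
  s \in msupp (ext f p) -> exists2 t, t \in msupp p & s \in msupp (f t).
Proof.
move=> sp; have [/hasP[t tp sf]|no] :=
  boolP (has (fun t => s \in msupp (f t)) (msupp p)); first by exists t.
move: sp; rewrite -mcoeff_neq0 mcoeff_ext big1_seq ?eqxx // => t /= tp.
have /mcoeff_outdom -> : s \notin msupp (f t).
  by apply: contra no => ?; apply/hasP; exists t.
by rewrite mulr0.
Qed.

End LinearExtension.

(* Stated at type [k], from which unification does not recover [k^o]. *)
Lemma eq_ext_regular (k : fieldType) (T : choiceType) (f g : T -> k)
    (p : {malg k[T]}) :
  {in msupp p, f =1 g} -> ext (V := k^o) f p = ext (V := k^o) g p :> k.
Proof. exact: (@eq_ext k T k^o f g p). Qed.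

Lemma ext_ext (k : fieldType) (T S : choiceType) (V : lmodType k)
    (h : S -> V) (f : T -> {malg k[S]}) (p : {malg k[T]}) :
  ext h (ext f p) = ext (fun t => ext h (f t)) p.
Proof. by rewrite ext_linear; apply: eq_ext. Qed.

Lemma ext_map (k : fieldType) (T S : choiceType) (V : lmodType k)
    (h : S -> V) (f : T -> S) (p : {malg k[T]}) :
  ext h (ext (fun a => << f a >>) p) = ext (h \o f) p.
Proof. by rewrite ext_ext; apply: eq_ext => a _ /=; rewrite extU. Qed.

Lemma ext_map2 (k : fieldType) (T T' S : choiceType) (V : lmodType k)
    (h : S -> V) (f : T -> T' -> S) (p : {malg k[T]}) (q : {malg k[T']}) :
  ext h (ext (fun a => ext (fun b => << f a b >>) q) p)
    = ext (fun a => ext (fun b => h (f a b)) q) p.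
Proof. by rewrite ext_ext; apply: eq_ext => a _ /=; rewrite ext_map. Qed.

Lemma linextE (k : fieldType) (X1 X2 : finType) f (p : {malg k[tree X1 X2]}) :
  linext f p = ext f p.
Proof. by rewrite unlock. Qed.

Lemma normal_form_Bin (k : fieldType) (X1 X2 : finType) (M : smodule k X1 X2)
    x (u v : tree X1 X2) :
  normal_form M (Bin x u v) =
    if (min_leaf u < min_leaf v)%N then
      ext (fun a => ext (fun b => << Bin x a b >>) (normal_form M v))
        (normal_form M u)
    else
      \sum_(y : X2) swap M x y *:
        ext (fun b => ext (fun a => << Bin y b a >>) (normal_form M u))
          (normal_form M v).
Proof. by rewrite unlock. Qed.

Lemma normal_form_Un (k : fieldType) (X1 X2 : finType) (M : smodule k X1 X2)
    x (u : tree X1 X2) :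
  normal_form M (Un x u) = ext (fun a => << Un x a >>) (normal_form M u).
Proof. by rewrite unlock. Qed.

Section Colours.
Variables (k : fieldType) (X1 X2 Omega : finType).

Notation tree0 := (tree X1 X2).
Notation vec := {malg k[tree0]}.
Notation ctree := (tree (Omega * X1)%type (Omega * X2)%type).
Notation cvec := {malg k[ctree]}.
Implicit Types (t u v : tree0) (D : ctree) (c : {ffun Omega -> nat}).
Implicit Types (M : smodule k X1 X2) (P : presentation k X1 X2).

Fixpoint uncolour D : tree0 :=
  match D with
  | Leaf i => Leaf i
  | Un x u => Un x.2 (uncolour u)
  | Bin x u v => Bin x.2 (uncolour u) (uncolour v)
  end.

Lemma leaves_uncolour D : leaves (uncolour D) = leaves D.
Proof. by elim: D => //= x u -> v ->. Qed.

Lemma weight_uncolour D : weight (uncolour D) = weight D.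
Proof. by elim: D => //= [x u -> | x u -> v ->]. Qed.

Lemma min_leaf_uncolour D : min_leaf (uncolour D) = min_leaf D.
Proof. by elim: D => //= x u -> v ->. Qed.

Lemma basis_tree_uncolour n D : basis_tree n (uncolour D) = basis_tree n D.
Proof.
rewrite /basis_tree leaves_uncolour; congr (_ && _).
by elim: D => //= x u -> v ->; rewrite !min_leaf_uncolour.
Qed.

Lemma tree_sign_uncolour D : tree_sign k (uncolour D) = tree_sign k D.
Proof.
rewrite /tree_sign leaves_uncolour.
by case: D => // x [i|y u|y u v] [j|z u'|z u' v'].
Qed.

Lemma relabel_uncolour f D : relabel f (uncolour D) = uncolour (relabel f D).
Proof. by elim: D => //= [x u -> | x u -> v ->]. Qed.

Lemma colours_relabel f D : colours (relabel f D) = colours D.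
Proof. by elim: D => //= [x u -> | x u -> v ->]. Qed.

Lemma size_colours D : size (colours D) = weight D.
Proof.
by elim: D => //= [x u -> | x u IHu v IHv] //; rewrite size_cat IHu IHv.
Qed.

Section Sums.
Variables (R : Type) (idx : R) (op : Monoid.com_law idx).

Lemma big_colourings_Un (F : ctree -> R) x u :
  \big[op/idx]_(D <- colourings Omega (Un x u)) F D
    = \big[op/idx]_(w : Omega) \big[op/idx]_(D <- colourings Omega u)
        F (Un (w, x) D).
Proof. by rewrite /= big_allpairs_dep /= big_enum. Qed.

Lemma big_colourings_Bin (F : ctree -> R) x u v :
  \big[op/idx]_(D <- colourings Omega (Bin x u v)) F D
    = \big[op/idx]_(w : Omega) \big[op/idx]_(D <- colourings Omega u)
        \big[op/idx]_(D' <- colourings Omega v) F (Bin (w, x) D D').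
Proof. by rewrite /= !big_allpairs_dep /= big_enum. Qed.

End Sums.

(* [colourings] lists partial applications of [Bin], which have no decidable *)
(* equality; listing pairs instead gives access to the [allpairs] lemmas.    *)
Lemma colourings_Bin x u v :
  colourings Omega (Bin x u v)
    = [seq Bin (p.1, x) p.2 D' |
         p <- [seq (w, D) | w <- enum Omega, D <- colourings Omega u],
         D' <- colourings Omega v].
Proof.
rewrite /= -(map_allpairs (fun p : Omega * ctree => Bin (p.1, x) p.2) pair).
exact: allpairs_mapl.
Qed.

Lemma mem_colourings t D : (D \in colourings Omega t) = (uncolour D == t).
Proof.
apply/idP/eqP => [|<-].
  elim: t D => [i|x u IHu|x u IHu v IHv] D.
  - by rewrite inE => /eqP ->.
  - by case/allpairsP=> -[w u'] /= [_ /IHu <- ->].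
  - rewrite colourings_Bin.
    case/allpairsP=> -[p v'] /= [/allpairsP[[w u'] /= [_ /IHu <- ->]]].
    by move=> /IHv <- ->.
elim: D => [i|[w x] u IHu|[w x] u IHu v IHv]; first by rewrite inE.
  by apply/allpairsP; exists (w, u); rewrite mem_enum.
rewrite [uncolour _]/= colourings_Bin.
apply/allpairsP; exists ((w, u), v); split => //=.
by apply/allpairsP; exists (w, u); rewrite mem_enum.
Qed.

Lemma uniq_colourings t : uniq (colourings Omega t).
Proof.
elim: t => [i|x u IHu|x u IHu v IHv] //.
  apply: allpairs_uniq => //; first exact: enum_uniq.
  by move=> [w D] [w' D'] _ _ [-> ->].
rewrite colourings_Bin; apply: allpairs_uniq => //.
  apply: allpairs_uniq => //; first exact: enum_uniq.
  by move=> [w D] [w' D'].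
by move=> [[w E] D] [[w' E'] D'] _ _ /= [-> -> ->].
Qed.

Definition content D : {ffun Omega -> nat} :=
  [ffun w => count_mem w (colours D)].

Lemma mem_Col t c D : (D \in Col t c) = (uncolour D == t) && (content D == c).
Proof.
rewrite mem_filter mem_colourings andbC; congr (_ && _).
apply/forallP/eqP => [e|<- w]; last by rewrite ffunE.
by apply/ffunP => w; rewrite ffunE (eqP (e w)).
Qed.

Lemma uniq_Col t c : uniq (Col t c).
Proof. exact/filter_uniq/uniq_colourings. Qed.

Definition has_content c (s : seq Omega) : k :=
  [forall w, count_mem w s == c w]%:R.

Definition symmetric_fun (phi : seq Omega -> k) :=
  forall s s', perm_eq s s' -> phi s = phi s'.

Lemma symmetric_has_content c : symmetric_fun (has_content c).
Proof.
move=> s s' /seq.permP ss'; congr (nat_of_bool _)%:R.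
by apply: eq_forallb => w; rewrite ss'.
Qed.

Lemma has_contentE c D : has_content c (colours D) = (content D == c)%:R.
Proof.
congr (nat_of_bool _)%:R; apply/forallP/eqP => [e|<- w]; last by rewrite ffunE.
by apply/ffunP => w; rewrite ffunE (eqP (e w)).
Qed.

Lemma sum_Col (V : lmodType k) t c (F : ctree -> V) :
  \sum_(D <- Col t c) F D
    = \sum_(D <- colourings Omega t) has_content c (colours D) *: F D.
Proof.
rewrite big_filter big_mkcond; apply: eq_bigr => D _ /=.
by rewrite /has_content; case: ifP; rewrite ?scale1r ?scale0r.
Qed.

Section NormalForms.
Variable M : smodule k X1 X2.
Notation nf := (normal_form M).
Notation cnf := (normal_form (copies Omega M)).

Lemma sum_copies_swap (V : lmodType k) w x (F : Omega * X2 -> V) :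
  \sum_y copies_swap M (w, x) y *: F y = \sum_y swap M x y *: F (w, y).
Proof.
pose G z y := copies_swap M (w, x) (z, y) *: F (z, y).
rewrite (eq_bigr (fun p => G p.1 p.2)) => [|[] //]; rewrite -pair_bigA /G /=.
rewrite (bigD1 w) //= [X in _ + X]big1 ?addr0 => [|z /negbTE zw].
  by apply: eq_bigr => y _; rewrite /copies_swap /= eqxx.
by apply: big1 => y _; rewrite /copies_swap /= eq_sym zw scale0r.
Qed.

Lemma normal_form_copies_Bin w x (u v : ctree) :
  cnf (Bin (w, x) u v) =
    if (min_leaf u < min_leaf v)%N then
      ext (fun a => ext (fun b => << Bin (w, x) a b >>) (cnf v)) (cnf u)
    else
      \sum_(y : X2) swap M x y *:
        ext (fun b => ext (fun a => << Bin (w, y) b a >>) (cnf u)) (cnf v).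
Proof.
rewrite normal_form_Bin; case: ifP => // _.
exact: (sum_copies_swap w x (fun y =>
  ext (fun b => ext (fun a => << Bin y b a >>) (cnf u)) (cnf v))).
Qed.

(* The weight [phi] is not restricted to [has_content c], so that the colours *)
(* outside a subtree can be fixed in an induction.                            *)
Definition sums_colours t := forall phi, symmetric_fun phi ->
  forall (V : lmodType k) (h : ctree -> V),
  \sum_(D <- colourings Omega t) phi (colours D) *: ext h (cnf D)
    = ext (fun a => \sum_(A <- colourings Omega a) phi (colours A) *: h A) (nf t).

Lemma sums_colours2 u v : sums_colours u -> sums_colours v ->
  forall phi, symmetric_fun phi ->
  forall (V : lmodType k) (h : ctree -> ctree -> V),
  \sum_(D <- colourings Omega u) \sum_(D' <- colourings Omega v)
      phi (colours D ++ colours D') *: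
        ext (fun a => ext (fun b => h a b) (cnf D')) (cnf D)
    = ext (fun a => ext (fun b =>
        \sum_(A <- colourings Omega a) \sum_(B <- colourings Omega b)
          phi (colours A ++ colours B) *: h A B) (nf v)) (nf u).
Proof.
move=> IHu IHv phi hphi V h; rewrite exchange_big /=.
under eq_bigr => D' _.
  rewrite (IHu (fun s => phi (s ++ colours D'))); last first.
    by move=> s s' ss'; apply: hphi; rewrite perm_cat2r.
  over.
rewrite -ext_sum; apply: eq_ext => a _ /=; rewrite exchange_big ext_sum.
apply: eq_bigr => A _ /=.
by rewrite (IHv (fun s => phi (colours A ++ s))) => // s s' ss';
  apply: hphi; rewrite perm_cat2l.
Qed.

Lemma min_leaf_colouring D t :
  D \in colourings Omega t -> min_leaf D = min_leaf t.
Proof. by rewrite mem_colourings => /eqP <-; rewrite min_leaf_uncolour. Qed.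

Lemma sums_colours_normal_form t : sums_colours t.
Proof.
elim: t => [i|x u IHu|x u IHu v IHv] phi hphi V h.
- by rewrite /= extU !big_seq1 extU.
- rewrite big_colourings_Un normal_form_Un ext_map.
  rewrite (eq_ext (fun a _ => big_colourings_Un _ _ x a)) ext_sum.
  apply: eq_bigr => w _; rewrite -(IHu (fun s => phi (w :: s))) => [|s s' ss'].
    by apply: eq_bigr => D _; rewrite normal_form_Un ext_map.
  by apply: hphi; rewrite perm_cons.
- rewrite big_colourings_Bin.
  have key y a b : sums_colours a -> sums_colours b ->
      \sum_(w : Omega) \sum_(D <- colourings Omega a)
        \sum_(D' <- colourings Omega b) phi (w :: colours D ++ colours D') *:
          ext (fun A => ext (fun B => h (Bin (w, y) A B)) (cnf D')) (cnf D)
      = ext (fun a' => ext (fun b' => \sum_(A <- colourings Omega (Bin y a' b'))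
          phi (colours A) *: h A) (nf b)) (nf a).
    move=> IHa IHb; rewrite [RHS](eq_ext (fun a' _ =>
      eq_ext (fun b' _ => big_colourings_Bin _ _ y a' b'))).
    rewrite [RHS](eq_ext (fun a' _ => ext_sum _ _ _)) ext_sum.
    apply: eq_bigr => w _; have inv : symmetric_fun (fun s => phi (w :: s)).
      by move=> s s' ss'; apply: hphi; rewrite perm_cons.
    exact: (sums_colours2 IHa IHb inv (fun A B => h (Bin (w, y) A B))).
  have minE D D' : D \in colourings Omega u -> D' \in colourings Omega v ->
    (min_leaf (D : ctree) < min_leaf (D' : ctree))%N = (min_leaf u < min_leaf v)%N.
    by move=> /min_leaf_colouring -> /min_leaf_colouring ->.
  rewrite normal_form_Bin.
  case uv: (min_leaf u < min_leaf v)%N.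
    rewrite ext_map2 -key //; apply: eq_bigr => w _.
    apply: eq_big_seq => D Du; apply: eq_big_seq => D' Dv.
    by rewrite normal_form_copies_Bin minE // uv ext_map2.
  rewrite ext_lincomb; transitivity (\sum_(y : X2) swap M x y *:
    \sum_(w : Omega) \sum_(D <- colourings Omega u) \sum_(D' <- colourings Omega v)
      phi (w :: colours D' ++ colours D) *:
      ext (fun B => ext (fun A => h (Bin (w, y) B A)) (cnf D)) (cnf D')).
    under [RHS]eq_bigr => y _ do rewrite scaler_sumr.
    rewrite [RHS]exchange_big; apply: eq_bigr => w _.
    under [RHS]eq_bigr => y _ do rewrite scaler_sumr.
    rewrite [RHS]exchange_big; apply: eq_big_seq => D Du.
    under [RHS]eq_bigr => y _ do rewrite scaler_sumr.
    rewrite [RHS]exchange_big; apply: eq_big_seq => D' Dv.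
    rewrite normal_form_copies_Bin minE // uv ext_lincomb scaler_sumr.
    apply: eq_bigr => y _; rewrite ext_map2 !scalerA mulrC.
    by congr (_ * _ *: _); apply: hphi; rewrite perm_cons perm_catC.
  apply: eq_bigr => y _; rewrite ext_map2 -key //.
  by congr (_ *: _); apply: eq_bigr => w _; apply: exchange_big.
Qed.

Lemma ext_uncolour_normal_form phi : symmetric_fun phi ->
  forall (V : lmodType k) (h : tree0 -> V) D,
  ext (fun A => phi (colours A) *: h (uncolour A)) (cnf D)
    = phi (colours D) *: ext h (nf (uncolour D)).
Proof.
move=> hphi V h D.
elim: D phi hphi h => [i|[w x] u IHu|[w x] u IHu v IHv] phi hphi h.
- by rewrite /= !extU.
- rewrite [uncolour _]/= !normal_form_Un !ext_map.
  rewrite (IHu (fun s => phi (w :: s)) _ (fun a => h (Un x a))) //.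
  by move=> s s' ss'; apply: hphi; rewrite perm_cons.
- have key y (a b : ctree) :
      (forall phi, symmetric_fun phi -> forall h : tree0 -> V,
        ext (fun A => phi (colours A) *: h (uncolour A)) (cnf a)
          = phi (colours a) *: ext h (nf (uncolour a))) ->
      (forall phi, symmetric_fun phi -> forall h : tree0 -> V,
        ext (fun A => phi (colours A) *: h (uncolour A)) (cnf b)
          = phi (colours b) *: ext h (nf (uncolour b))) ->
      ext (fun A => ext (fun B =>
          phi (w :: colours A ++ colours B) *: h (Bin y (uncolour A) (uncolour B)))
        (cnf b)) (cnf a)
      = phi (w :: colours a ++ colours b) *:
        ext (fun A => ext (fun B => h (Bin y A B)) (nf (uncolour b)))
          (nf (uncolour a)).
    move=> IHa IHb.
    under eq_ext => A _.
      rewrite (IHb (fun s => phi (w :: colours A ++ s)) _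
        (fun B => h (Bin y (uncolour A) B))); last first.
        by move=> s s' ss'; apply: hphi; rewrite perm_cons perm_cat2l.
      over.
    rewrite (IHa (fun s => phi (w :: s ++ colours b)) _
        (fun A => ext (fun B => h (Bin y A B)) (nf (uncolour b)))) //.
    by move=> s s' ss'; apply: hphi; rewrite perm_cons perm_cat2r.
  rewrite [uncolour _]/= normal_form_Bin !min_leaf_uncolour normal_form_copies_Bin.
  case: ifP => _; first by rewrite !ext_map2; apply: key.
  rewrite !ext_lincomb scaler_sumr; apply: eq_bigr => y _.
  rewrite !ext_map2 (key y v u IHv IHu) !scalerA mulrC.
  by congr (_ * _ *: _); apply: hphi; rewrite perm_cons perm_catC.
Qed.

End NormalForms.

End Colours.

Section Ideals.
Variables (k : fieldType) (X1 X2 : finType).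
Implicit Types (M : smodule k X1 X2) (p q : {malg k[tree X1 X2]}).

Lemma normal_form_swap M M' t :
  (forall x y, swap M x y = swap M' x y) -> normal_form M t = normal_form M' t.
Proof.
move=> eqM; elim: t => [i|x u IHu|x u IHu v IHv]; first by [].
  by rewrite !normal_form_Un IHu.
rewrite !normal_form_Bin IHu IHv.
case: (min_leaf u < min_leaf v)%N; first by [].
by apply: eq_bigr => y _; rewrite eqM.
Qed.

Lemma is_ideal_swap M M' I :
  (forall x y, swap M x y = swap M' x y) -> is_ideal M I -> is_ideal M' I.
Proof.
move=> eqM [h1 h2 h3 h4 h5 h6]; apply: (IsIdeal h1 h2 h3 _ h5 h6) => n s p.
suff <- : act M s p = act M' s p by apply: h4.
by apply: eq_bigr => t _; rewrite (normal_form_swap _ eqM).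
Qed.

Lemma ideal_gen_le M M' R R' :
    (forall x y, swap M x y = swap M' x y) ->
    (forall n p, R n p -> ideal_gen M' R' n p) ->
  forall n p, ideal_gen M R n p -> ideal_gen M' R' n p.
Proof.
move=> eqM sub n p Rp I II RI; apply: Rp => [|m r /sub]; last exact.
by apply: is_ideal_swap II => x y; rewrite eqM.
Qed.

Lemma ideal_gen_rel M R n p : R n p -> ideal_gen M R n p.
Proof. by move=> Rp I _; apply. Qed.

Lemma ideal_gen0 M R n : ideal_gen M R n 0.
Proof. by move=> I II _; apply: (ideal0 II). Qed.

Lemma ideal_genD M R n p q :
  ideal_gen M R n p -> ideal_gen M R n q -> ideal_gen M R n (p + q).
Proof.
move=> Rp Rq I II RI; rewrite -[p]scale1r.
by apply: (idealP II); [apply: Rp | apply: Rq].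
Qed.

Lemma ideal_genZ M R n a p : ideal_gen M R n p -> ideal_gen M R n (a *: p).
Proof.
move=> Rp I II RI; rewrite -[_ *: _]addr0.
by apply: (idealP II); [apply: Rp | apply: (ideal0 II)].
Qed.

Lemma ideal_gen_sum M R n (J : eqType) (r : seq J)
    (F : J -> {malg k[tree X1 X2]}) :
  (forall j, j \in r -> ideal_gen M R n (F j)) ->
  ideal_gen M R n (\sum_(j <- r) F j).
Proof.
move=> RF; rewrite big_seq; elim/big_ind: _ => //; first exact: ideal_gen0.
by move=> p q; apply: ideal_genD.
Qed.

End Ideals.

Arguments ideal_gen_rel {k X1 X2 M R n p} _ [I] _ _.
Arguments ideal_genD {k X1 X2 M R n p q} _ _ [I] _ _.
Arguments ideal_genZ {k X1 X2 M R n} a {p} _ [I] _ _.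
Arguments ideal_gen_sum {k X1 X2 M R n J r F} _ [I] _ _.

Section Pairing.
Variables (k : fieldType) (X1 X2 : finType).
Notation vec := {malg k[tree X1 X2]}.
Implicit Types (f p : vec) (t : tree X1 X2) (M : smodule k X1 X2).

Lemma pairingEr f p :
  pairing f p = ext (V := k^o) (fun t => tree_sign k t * f@_t) p.
Proof. by rewrite extE; apply: eq_bigr => t _; rewrite mulrC. Qed.

Lemma pairingEl f p :
  pairing f p = ext (V := k^o) (fun t => tree_sign k t * p@_t) f.
Proof.
rewrite pairingEr (@ext_widen _ _ _ _ p (msupp f `|` msupp p)%fset) ?fsubsetUr //.
rewrite (@ext_widen _ _ _ _ f (msupp f `|` msupp p)%fset) ?fsubsetUl //.
apply: eq_bigr => t _; rewrite /GRing.scale /=.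
by rewrite mulrCA [RHS]mulrCA [p@_t * _]mulrC.
Qed.

Lemma pairing0r f : pairing f 0 = 0.
Proof. by rewrite pairingEr linear0. Qed.

Lemma pairing_sumr f I (r : seq I) (p : I -> vec) :
  pairing f (\sum_(i <- r) p i) = \sum_(i <- r) pairing f (p i).
Proof.
by rewrite pairingEr linear_sum; apply: eq_bigr => i _; rewrite pairingEr.
Qed.

Lemma pairingZl a f p : pairing (a *: f) p = a * pairing f p.
Proof. by rewrite !pairingEl linearZ. Qed.

Lemma actE M n (s : 'S_n) p :
  act M s p = ext (fun t => normal_form M (relabel (perm_label s) t)) p.
Proof. exact: linextE. Qed.

Lemma act_sum M n (s : 'S_n) I (r : seq I) (p : I -> vec) :
  act M s (\sum_(i <- r) p i) = \sum_(i <- r) act M s (p i).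
Proof.
by rewrite actE linear_sum; apply: eq_bigr => i _; rewrite actE.
Qed.

Lemma act0 M n (s : 'S_n) : act M s 0 = 0 :> vec.
Proof. by rewrite actE linear0. Qed.

Lemma actZ M n (s : 'S_n) a p : act M s (a *: p) = a *: act M s p.
Proof. by rewrite !actE ext_scale. Qed.

Lemma actB M n (s : 'S_n) p q : act M s (p - q) = act M s p - act M s q.
Proof. by rewrite !actE linearB. Qed.

Lemma pairingBr f p q : pairing f (p - q) = pairing f p - pairing f q.
Proof. by rewrite !pairingEr linearB. Qed.

Lemma pairingZr a f p : pairing f (a *: p) = a * pairing f p.
Proof. by rewrite !pairingEr linearZ. Qed.

Lemma pairing0l p : pairing 0 p = 0.
Proof. by rewrite pairingEl linear0. Qed.

Lemma orthogonal0 M R n : orthogonal M R n 0.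
Proof. by split=> [t|r _ s]; rewrite ?msupp0 // pairing0l. Qed.

Lemma orthogonalZ M R n a f : orthogonal M R n f -> orthogonal M R n (a *: f).
Proof.
case=> fn fR; split=> [t /(fsubsetP (msuppZ_le a f))/fn //|r Rr s].
by rewrite pairingZl fR ?mulr0.
Qed.

Lemma act1_basis_tree M n t : basis_tree n t -> act M (1 : 'S_n)%g << t >> = << t >>.
Proof.
case/andP => sh _; rewrite actE extU.
have -> : relabel (perm_label (1 : 'S_n)%g) t = t.
  elim: t {sh} => //= [i|x u -> | x u -> v ->] //; congr Leaf.
  by rewrite /perm_label; case: insubP => // j _ <-; rewrite perm1.
elim: t sh => [i|x u IHu|x u IHu v IHv] // sh.
  by rewrite normal_form_Un IHu // extU.
case/and3P: sh => uv su sv.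
by rewrite normal_form_Bin uv IHu // IHv // !extU.
Qed.

Lemma mcoeff_sum_basis (r : vec) t : \sum_(u <- msupp r) r@_u * (t == u)%:R = r@_t.
Proof.
rewrite -[in RHS](ext_id r) mcoeff_ext; apply: eq_bigr => u _.
by rewrite mcoeffU eq_sym.
Qed.

Lemma sum_indicator (T : eqType) (s : seq T) x :
  uniq s -> \sum_(y <- s) (y == x)%:R = (x \in s)%:R :> k.
Proof.
move=> us; rewrite -natr_sum -(count_uniq_mem _ us) -sum1_count [in RHS]big_mkcond.
by congr (_%:R); apply: eq_bigr => y _ /=; case: (y == x).
Qed.

End Pairing.

Section Polarization.
Variables (k : fieldType) (X1 X2 Omega : finType).
Notation vec := {malg k[tree X1 X2]}.
Notation ctree := (tree (Omega * X1)%type (Omega * X2)%type).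
Notation cvec := {malg k[ctree]}.
Implicit Types (t u v : tree X1 X2) (D : ctree) (c : {ffun Omega -> nat}).
Implicit Types (M : smodule k X1 X2) (P : presentation k X1 X2).

Lemma polarizeE (r : vec) c :
  polarize r c = ext (fun t => \sum_(D <- Col t c) << D >>) r.
Proof. by rewrite extE. Qed.

(* The adjoint of [polarize ^~ c] for the pairings. *)
Definition uncoloured c (f : cvec) : vec :=
  ext (fun D => (content D == c)%:R *: << uncolour D >>) f.

Lemma mcoeff_polarize (r : vec) c D :
  (polarize r c)@_D = (content D == c)%:R * r@_(uncolour D).
Proof.
rewrite polarizeE mcoeff_ext -mcoeff_sum_basis mulr_sumr.
apply: eq_bigr => t _; rewrite mulrCA -natrM mulnb andbC -mem_Col; congr (_ * _).
rewrite (raddf_sum (mcoeff D)) /=; under eq_bigr => A _ do rewrite mcoeffU.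
exact/sum_indicator/uniq_Col.
Qed.

Lemma pairing_uncoloured f p c :
  pairing (uncoloured c f) p = pairing f (polarize p c).
Proof.
rewrite !pairingEl /uncoloured ext_ext; apply: eq_ext_regular => D _.
rewrite linearZ /= extU mcoeff_polarize -tree_sign_uncolour mulrCA.
by [].
Qed.

Lemma pairing_polarize g c p :
  pairing (polarize g c) p = pairing g (uncoloured c p).
Proof.
rewrite !pairingEr /uncoloured ext_ext; apply: eq_ext_regular => D _.
rewrite linearZ /= extU mcoeff_polarize -tree_sign_uncolour mulrCA.
by [].
Qed.

Lemma sum_colourings_relabel (V : lmodType k) f t (F : ctree -> V) :
  \sum_(D <- colourings Omega (relabel f t)) F D
    = \sum_(D <- colourings Omega t) F (relabel f D).
Proof.
elim: t F => [i|x u IHu|x u IHu v IHv] F; first by rewrite !big_seq1.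
  by rewrite [relabel _ _]/= !big_colourings_Un; apply: eq_bigr => w _; rewrite IHu.
rewrite [relabel _ _]/= !big_colourings_Bin; apply: eq_bigr => w _; rewrite IHu.
by apply: eq_bigr => D _; rewrite IHv.
Qed.

Lemma act_polarize M n (s : 'S_n) r c :
  act (copies Omega M) s (polarize r c) = polarize (act M s r) c.
Proof.
rewrite !actE !polarizeE !ext_ext; apply: eq_ext => t _.
set f := perm_label s.
under [RHS]eq_ext => a _ do rewrite sum_Col.
rewrite -(sums_colours_normal_form M _ (symmetric_has_content _ c)).
rewrite sum_colourings_relabel ext_sumr sum_Col.
by apply: eq_bigr => D _; rewrite ext_id colours_relabel extU.
Qed.

Lemma act_uncoloured M n (s : 'S_n) p c :
  uncoloured c (act (copies Omega M) s p) = act M s (uncoloured c p).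
Proof.
rewrite !actE /uncoloured !ext_ext; apply: eq_ext => D _.
rewrite ext_scale extU.
under [LHS]eq_ext => A _ do rewrite -has_contentE.
rewrite (ext_uncolour_normal_form M (symmetric_has_content _ c)
  (fun t => << t >>)).
by rewrite ext_id colours_relabel has_contentE relabel_uncolour.
Qed.

Lemma mcoeff_uncoloured c f t :
  (uncoloured c f)@_t = \sum_(D <- Col t c) f@_D.
Proof.
under eq_bigr => D _ do rewrite -mcoeff_sum_basis.
rewrite exchange_big mcoeff_ext; apply: eq_bigr => D _ /=.
under eq_bigr => A _ do rewrite eq_sym.
rewrite -mulr_sumr.
under eq_bigr => A _ do rewrite eq_sym.
rewrite sum_indicator ?uniq_Col // mem_Col mcoeffZ mcoeffU.
by rewrite -natrM mulnb andbC.
Qed.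

Lemma mem_msupp_polarize (r : vec) c D :
  D \in msupp (polarize r c) -> uncolour D \in msupp r.
Proof.
rewrite -!mcoeff_neq0 mcoeff_polarize; apply: contraNneq => ->.
by rewrite mulr0.
Qed.

Lemma in_free2_polarize n (r : vec) c :
  in_free2 n r -> in_free2 n (polarize r c).
Proof.
move=> rn D /mem_msupp_polarize/rn.
by rewrite basis_tree_uncolour weight_uncolour.
Qed.

Lemma in_free2_uncoloured n f c : in_free2 n f -> in_free2 n (uncoloured c f).
Proof.
move=> fn t /msupp_ext[D /fn Dn]; rewrite -basis_tree_uncolour in Dn.
rewrite -weight_uncolour in Dn.
have [_|_] := eqVneq (content D) c; last by rewrite scale0r msupp0.
by rewrite scale1r msuppU oner_eq0 inE => /eqP ->.
Qed.

Lemma content2_content D : weight D = 2%N -> content2 (content D).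
Proof.
move=> wD; rewrite /content2 -wD -size_colours.
under eq_bigr => w _ do rewrite ffunE -sum1_count big_mkcond.
rewrite exchange_big /= -sum1_size; apply: eq_bigr => w _.
by rewrite (bigD1 w) //= eqxx big1 // => v; rewrite eq_sym => /negbTE ->.
Qed.

Lemma sum_uncoloured (J : seq {ffun Omega -> nat}) (V : lmodType k)
    (F : {ffun Omega -> nat} -> ctree -> V) f :
  uniq J -> (forall D, D \in msupp f -> content D \in J) ->
  \sum_(c <- J) ext (fun D => (content D == c)%:R *: F c D) f
    = ext (fun D => F (content D) D) f.
Proof.
move=> uJ fJ; rewrite -ext_sum; apply: eq_ext => D Df.
rewrite (bigD1_seq (content D)) ?fJ //= eqxx scale1r big1 ?addr0 // => c.
by rewrite eq_sym => /negbTE ->; rewrite scale0r.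
Qed.

Fixpoint sum_words m (F : seq Omega -> nat) : nat :=
  if m is m'.+1 then \sum_(w : Omega) sum_words m' (fun s => F (w :: s))
  else F [::].

Lemma sum_words_cat m m' F :
  sum_words (m + m') F
    = sum_words m (fun s => sum_words m' (fun s' => F (s ++ s'))).
Proof. by elim: m F => //= m IH F; apply: eq_bigr => w _; rewrite IH. Qed.

Lemma sum_colourings_words t (F : seq Omega -> nat) :
  \sum_(D <- colourings Omega t) F (colours D) = sum_words (weight t) F.
Proof.
elim: t F => [i|x u IHu|x u IHu v IHv] F; first by rewrite big_seq1.
  by rewrite big_colourings_Un /=; apply: eq_bigr => w _; rewrite -IHu.
rewrite big_colourings_Bin /=; apply: eq_bigr => w _.
rewrite sum_words_cat -IHu; apply: eq_bigr => D _.
by rewrite -IHv.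
Qed.

Lemma content2P c : content2 c ->
  exists a b, forall w, c w = ((a == w) + (b == w))%N.
Proof.
have step m (d : {ffun Omega -> nat}) : (\sum_w d w = m.+1)%N ->
    exists a (e : {ffun Omega -> nat}),
      (\sum_w e w = m)%N /\ forall w, d w = ((a == w) + e w)%N.
  move=> dm; have /exists_inP[a _ da] : [exists (a | true), d a != 0%N].
    rewrite -negb_forall_in; apply/negP => /forall_inP d0.
    by move: dm; rewrite big1 // => w _; apply/eqP/d0.
  exists a, [ffun w => (d w - (a == w))%N].
  have dE w : d w = ((a == w) + (d w - (a == w)))%N.
    by rewrite subnKC //; case: eqP => // <-; rewrite lt0n.
  split=> [|w]; last by rewrite ffunE.
  under eq_bigr => w _ do rewrite ffunE.
  have : (\sum_w (a == w) + \sum_w (d w - (a == w)) = m.+1)%N.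
    by rewrite -big_split -dm; apply: eq_bigr => w _; rewrite [RHS]dE.
  rewrite (bigD1 a) //= eqxx big1 => [[]//|w].
  by rewrite eq_sym => /negbTE ->.
move=> /step[a [d [/step[b [e [e0 de]]] ce]]]; exists a, b => w.
have /eqP := e0; rewrite sum_nat_eq0 => /forallP/(_ w)/eqP ew.
by rewrite ce de ew addn0.
Qed.

Lemma size_Col t c : weight t = 2%N -> content2 c ->
  size (Col t c) = (2`! %/ \prod_w (c w)`!)%N.
Proof.
move=> t2 /content2P[a [b cE]].
pose F s : nat := [forall w, count_mem w s == c w].
transitivity (\sum_w \sum_v F [:: w; v])%N.
  rewrite -[RHS]/(sum_words 2 F) -t2 -sum_colourings_words size_filter.
  by rewrite -sum1_count big_mkcond; apply: eq_bigr => D _; rewrite /F; case: ifP.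
have FE (w v : Omega) :
  F [:: w; v] = ((w == a) && (v == b)) || ((w == b) && (v == a)).
  rewrite /F; congr nat_of_bool; apply/forallP/orP => /= [H|].
    move: (H w) (H v); rewrite !cE !addn0 !eqxx (eq_sym w v).
    rewrite (eq_sym a w) (eq_sym b w) (eq_sym a v) (eq_sym b v).
    case: (eqVneq w a) => [wa|_]; case: (eqVneq v a) => [va|_];
      case: (eqVneq w b) => [wb|_]; case: (eqVneq v b) => [vb|_];
      case: (eqVneq v w) => [|vw] //=; (try by left); (try by right).
      by rewrite wa va eqxx in vw.
    by rewrite wb vb eqxx in vw.
  by case=> /andP[/eqP-> /eqP->] z; rewrite cE addn0 // addnC.
have sum1 x y : (\sum_(w : Omega) \sum_(v : Omega) ((w == x) && (v == y)) = 1)%N.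
  rewrite (bigD1 x) //= [X in (_ + X)%N]big1 => [|w wx]; last first.
    by rewrite big1 // => v _; rewrite (negbTE wx).
  rewrite (bigD1 y) //= !eqxx big1 // => v vy.
  by rewrite (negbTE vy).
have [ab|ab] := eqVneq a b.
  transitivity 1%N.
    rewrite -(sum1 a b); apply: eq_bigr => w _; apply: eq_bigr => v _.
    by rewrite FE ab orbb.
  rewrite (bigD1 a) //= big1 => [|w]; first by rewrite cE -ab eqxx.
  by rewrite cE -ab eq_sym => /negbTE ->.
transitivity 2%N.
  rewrite -[RHS](congr2 addn (sum1 a b) (sum1 b a)) -big_split.
  apply: eq_bigr => w _; rewrite -big_split; apply: eq_bigr => v _ /=.
  rewrite FE; have [->|_] := eqVneq w a; last by rewrite /= add0n.
  by rewrite (negbTE ab) /= orbF addn0.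
rewrite big1 // => w _; rewrite cE; have [<-|_] := eqVneq a w.
  by rewrite eq_sym (negbTE ab).
by case: (b == w).
Qed.

Lemma dual_copies_swap M x y :
  swap (dual (copies Omega M)) x y = swap (copies Omega (dual M)) x y.
Proof.
rewrite /= /dual_swap /= /copies_swap eq_sym.
by case: ifP; rewrite ?oppr0.
Qed.

Lemma LC_orthogonalP P n f :
  orthogonal (copies Omega (gens P)) (LC_rels P) n f <->
  in_free2 n f /\ forall c, content2 c ->
    orthogonal (gens P) (rels P) n (uncoloured c f).
Proof.
split=> [[fn fR]|[fn fR]]; split=> //.
  move=> c c2; split=> [|r Rr s]; first exact: in_free2_uncoloured.
  by rewrite pairing_uncoloured -act_polarize; apply: fR.
move=> _ [r c Rr c2] s; rewrite act_polarize -pairing_uncoloured.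
by case: (fR c c2) => _; apply.
Qed.

Lemma in_free2_TC n t c D D' : basis_tree n t -> weight t = 2%N ->
  D \in Col t c -> D' \in Col t c -> in_free2 n (<< D >> - << D' >> : cvec).
Proof.
move=> tn t2; rewrite !mem_Col => /andP[/eqP tD _] /andP[/eqP tD' _] A.
move=> /(fsubsetP (msuppB_le _ _)); rewrite !msuppU oner_eq0 !inE.
by case/orP=> /eqP ->; rewrite -basis_tree_uncolour -weight_uncolour ?tD ?tD' tn t2.
Qed.

Lemma uncoloured_TC c t c' D D' : D \in Col t c' -> D' \in Col t c' ->
  uncoloured c (<< D >> - << D' >>) = 0.
Proof.
rewrite !mem_Col => /andP[/eqP tD /eqP cD] /andP[/eqP tD' /eqP cD'].
by rewrite /uncoloured linearB /= !extU tD tD' cD cD' subrr.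
Qed.

Definition contents (f : cvec) := undup [seq content D | D <- msupp f].

Lemma mem_contents (f : cvec) D : D \in msupp f -> content D \in contents f.
Proof. by move=> Df; rewrite mem_undup map_f. Qed.

Lemma contents_content2 n (f : cvec) c : in_free2 n f -> c \in contents f ->
  exists D, [/\ D \in msupp f, content D = c & content2 c].
Proof.
move=> fn; rewrite mem_undup => /mapP[D Df ->]; exists D; split=> //.
by apply: content2_content; apply/eqP; case/andP: (fn _ Df).
Qed.

Lemma multinomial_content_gt0 D : weight D = 2%N ->
  (0 < 2`! %/ \prod_w (content D w)`!)%N.
Proof.
move=> D2; have c2 := content2_content D2.
rewrite -(@size_Col (uncolour D) _ _ c2) ?weight_uncolour //.
by rewrite -has_predT; apply/hasP; exists D; rewrite // mem_Col !eqxx.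
Qed.

Section Listing.
Variable E : vec -> {ffun Omega -> nat} -> tree X1 X2 -> seq ctree.
Hypothesis hE : is_listing E.

Definition matching r c j : cvec := ext (fun t => << nth (Leaf 0) (E r c t) j >>) r.

Lemma matchingE r c j :
  matching r c j = \sum_(t <- msupp r) r@_t *: << nth (Leaf 0) (E r c t) j >>.
Proof. by rewrite /matching extE. Qed.

Lemma nth_listing n r c t j : in_free2 n r -> t \in msupp r -> content2 c ->
  (j < 2`! %/ \prod_w (c w)`!)%N -> nth (Leaf 0) (E r c t) j \in Col t c.
Proof.
move=> rn /rn/andP[_ /eqP t2] c2; rewrite -(size_Col t2 c2) => jb.
by rewrite -(perm_mem (hE r c t)) mem_nth // (perm_size (hE r c t)).
Qed.

Lemma in_free2_matching n r c j : in_free2 n r -> content2 c ->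
  (j < 2`! %/ \prod_w (c w)`!)%N -> in_free2 n (matching r c j).
Proof.
move=> rn c2 jb D /msupp_ext[t tr]; rewrite msuppU oner_eq0 inE => /eqP ->.
have := nth_listing rn tr c2 jb; rewrite mem_Col => /andP[/eqP tE _].
by rewrite -basis_tree_uncolour -weight_uncolour tE; apply: rn.
Qed.

Lemma uncoloured_matching n r c c' j : in_free2 n r -> content2 c ->
  (j < 2`! %/ \prod_w (c w)`!)%N ->
  uncoloured c' (matching r c j) = (c == c')%:R *: r.
Proof.
move=> rn c2 jb; rewrite /uncoloured ext_ext -[in RHS](ext_id r) -extZ.
apply: eq_ext => t tr; rewrite extU.
have := nth_listing rn tr c2 jb; rewrite mem_Col.
by case/andP=> /eqP -> /eqP ->.
Qed.

Lemma sum_matching n r c : in_free2 n r -> content2 c ->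
  \sum_(j < 2`! %/ \prod_w (c w)`!) matching r c j = polarize r c.
Proof.
move=> rn c2; rewrite -ext_sum polarizeE; apply: eq_ext => t tr.
have /andP[_ /eqP t2] := rn t tr.
rewrite -(perm_big _ (hE r c t)) /= (big_nth (Leaf 0)) big_mkord.
by rewrite (perm_size (hE r c t)) (size_Col t2 c2).
Qed.

Lemma matching_TCall P n r c j : rels P n r -> content2 c ->
  (j < 2`! %/ \prod_w (c w)`!)%N -> rels (TCall E P) n (matching r c j).
Proof. by move=> Rr c2 jb; left; rewrite matchingE; constructor. Qed.

Lemma TCall_relsW P n f (Q : cvec -> Prop) :
  (forall r c j, rels P n r -> content2 c ->
     (j < 2`! %/ \prod_w (c w)`!)%N -> Q (matching r c j)) ->
  (forall t c D D', basis_tree n t -> weight t = 2%N -> content2 c ->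
     D \in Col t c -> D' \in Col t c -> Q (<< D >> - << D' >>)) ->
  rels (TCall E P) n f -> Q f.
Proof.
move=> QM QT [[r c j Rr c2 jb]|[t c D D' /andP[tn /eqP t2] c2 DD DD']].
  by rewrite -matchingE; apply: QM.
exact: (QT t c).
Qed.

Lemma koszul_dual_LC P :
  same_operad (koszul_dual (LC Omega P)) (TCall E (koszul_dual P)).
Proof.
split=> [x y|n f]; first exact: dual_copies_swap.
split; apply: ideal_gen_le => [x y|m p].
- exact: dual_copies_swap.
- move=> /LC_orthogonalP[pm pR].
  pose d c D := nth (Leaf 0) (E (uncoloured c p) c (uncolour D)) 0.
  have dE c : matching (uncoloured c p) c 0
      = ext (fun D => (content D == c)%:R *: << d c D >>) p.
    rewrite /matching ext_ext; apply: eq_ext => D _.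
    by rewrite ext_scale extU.
  have -> : p = \sum_(c <- contents p) matching (uncoloured c p) c 0
      + \sum_(D <- msupp p) p@_D *: (<< D >> - << d (content D) D >>).
    rewrite (eq_bigr _ (fun c _ => dE c)).
    rewrite (sum_uncoloured (fun c D => << d c D >>)) ?undup_uniq //; last first.
      exact: mem_contents.
    rewrite -extE -extD -[LHS](ext_id p); apply: eq_ext => D _.
    by rewrite addrC subrK.
  refine (ideal_genD (ideal_gen_sum _) (ideal_gen_sum _)).
    move=> c /(contents_content2 pm)[D [Dp cD c2]]; apply: ideal_gen_rel.
    apply: matching_TCall; [exact: pR | exact: c2 |].
    rewrite -cD multinomial_content_gt0 //.
    by apply/eqP; case/andP: (pm D Dp).
  move=> D Dp; have /andP[Dm /eqP D2] := pm D Dp.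
  have c2 := content2_content D2.
  refine (ideal_genZ _ (ideal_gen_rel _)); right.
  have DC : D \in Col (uncolour D) (content D) by rewrite mem_Col !eqxx.
  apply: (@TCRel _ _ _ _ _ _ (uncolour D) (content D)) => //.
    by rewrite basis_tree_uncolour weight_uncolour Dm D2.
  have EC := hE (uncoloured (content D) p) (content D) (uncolour D).
  rewrite -(perm_mem EC) mem_nth // (perm_size EC).
  by case: (Col _ _) DC.
- by rewrite dual_copies_swap.
- move=> pT; apply: ideal_gen_rel; move: pT; apply: TCall_relsW.
    move=> r c j Rr c2 jb; have rm : in_free2 m r by case: Rr.
    apply/LC_orthogonalP; split=> [|c' _]; first exact: in_free2_matching.
    by rewrite (uncoloured_matching _ rm) //; apply: orthogonalZ.
  move=> t c D D' tm t2 c2 DD DD'; apply/LC_orthogonalP.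
  split=> [|c' _]; first exact: (in_free2_TC tm t2 DD DD').
  by rewrite (uncoloured_TC _ DD DD'); apply: orthogonal0.
Qed.

Lemma TCall_orthogonal_const P n f t c D D' :
  orthogonal (copies Omega (gens P)) (rels (TCall E P)) n f ->
  basis_tree n t -> weight t = 2%N -> content2 c ->
  D \in Col t c -> D' \in Col t c -> f@_D = f@_D'.
Proof.
move=> [fn fR] tn t2 c2 DC DC'.
have basisC A : A \in Col t c -> basis_tree n A.
  by rewrite mem_Col -basis_tree_uncolour => /andP[/eqP -> _].
have sgC A : A \in Col t c -> tree_sign k A = tree_sign k t.
  by rewrite mem_Col -tree_sign_uncolour => /andP[/eqP -> _].
have /(fR _)/(_ 1%g) : rels (TCall E P) n (<< D >> - << D' >>).
  by right; apply: (@TCRel _ _ _ _ _ _ t c); rewrite ?tn ?t2.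
rewrite actB !act1_basis_tree ?basisC //.
rewrite pairingBr !pairingEr !extU !sgC // -mulrBr => /eqP.
by rewrite mulf_eq0 signr_eq0 /= subr_eq0 => /eqP.
Qed.

Lemma TCall_orthogonal_uncoloured P (hP : quadratic P) n f :
  orthogonal (copies Omega (gens P)) (rels (TCall E P)) n f ->
  forall c, content2 c -> orthogonal (gens P) (rels P) n (uncoloured c f).
Proof.
move=> [fn fR] c c2; split=> [|r Rr s]; first exact: in_free2_uncoloured.
rewrite pairing_uncoloured -act_polarize -(sum_matching (hP _ _ Rr) c2).
rewrite act_sum pairing_sumr big1 // => j _.
by apply: fR; apply: matching_TCall.
Qed.

Lemma koszul_dual_TCall (hk : [pchar k] =i pred0) P (hP : quadratic P) :
  same_operad (koszul_dual (TCall E P)) (LC Omega (koszul_dual P)).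
Proof.
split=> [x y|n f]; first exact: dual_copies_swap.
split; apply: ideal_gen_le => [x y|m p].
- exact: dual_copies_swap.
- move=> pT; have [pm _] := pT.
  pose b c : k := (2`! %/ \prod_w (c w)`!)%:R.
  have key D : (uncoloured (content D) p)@_(uncolour D) = b (content D) * p@_D.
    have [/andP[Dm /eqP D2]|noD] := boolP (basis_tree m D && (weight D == 2%N)).
      have c2 := content2_content D2.
      have DC : D \in Col (uncolour D) (content D) by rewrite mem_Col !eqxx.
      rewrite mcoeff_uncoloured (eq_big_seq (fun=> p@_D)) => [|A AC]; last first.
        by apply: (TCall_orthogonal_const pT _ _ c2 AC DC);
          rewrite ?basis_tree_uncolour ?weight_uncolour.
      rewrite big_const_seq count_predT iter_addr_0 size_Col ?weight_uncolour //.
      by rewrite mulr_natl.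
    rewrite !mcoeff_outdom ?mulr0 //; apply: contra noD; first exact: pm.
    move=> /(in_free2_uncoloured pm).
    by rewrite basis_tree_uncolour weight_uncolour.
  have -> : p = \sum_(c <- contents p) (b c)^-1 *: polarize (uncoloured c p) c.
    apply/malgP => D; rewrite (raddf_sum (mcoeff D)) /=.
    have [Dp|Dp] := boolP (D \in msupp p); last first.
      rewrite big1 ?mcoeff_outdom // => c _; rewrite mcoeffZ mcoeff_polarize.
      have [<-|_] := eqVneq (content D) c; last by rewrite mul0r mulr0.
      by rewrite key (mcoeff_outdom Dp) !mulr0.
    rewrite (bigD1_seq (content D)) ?mem_contents ?undup_uniq //=.
    rewrite big1 ?addr0 => [|c /negbTE]; last first.
      by rewrite mcoeffZ mcoeff_polarize eq_sym => ->; rewrite mul0r mulr0.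
    rewrite mcoeffZ mcoeff_polarize eqxx mul1r key mulKf //.
    rewrite (pcharf0P k).1 // -lt0n multinomial_content_gt0 //.
    by apply/eqP; case/andP: (pm D Dp).
  refine (ideal_gen_sum _) => c /(contents_content2 pm)[_ [_ _ c2]].
  refine (ideal_genZ _ (ideal_gen_rel _)).
  by constructor => //; apply: TCall_orthogonal_uncoloured.
- by rewrite dual_copies_swap.
- case=> r c [rm rR] c2; apply: ideal_gen_rel; split.
    exact: in_free2_polarize.
  move=> q qT s; rewrite pairing_polarize act_uncoloured.
  apply: (TCall_relsW (Q := fun q => pairing r (act (gens P) s (uncoloured c q)) = 0))
    qT => [r' c' j Rr' c2' jb|t c' D D' _ _ _ DD DD'].
    by rewrite (uncoloured_matching _ (hP _ _ Rr')) // actZ pairingZr rR ?mulr0.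
  by rewrite (uncoloured_TC _ DD DD') act0 pairing0r.
Qed.

Lemma uncolour_inj : (#|Omega| <= 1)%N -> injective (@uncolour X1 X2 Omega).
Proof.
move=> /card_le1_eqP O1; have eqO (w w' : Omega) : w = w' by apply: O1.
elim=> [i|[w x] u IHu|[w x] u IHu v IHv] [j|[w' y] u'|[w' y] u' v'] //=.
- by case=> ->.
- by case=> -> /IHu ->; rewrite (eqO w w').
- by case=> -> /IHu -> /IHv ->; rewrite (eqO w w').
Qed.

Lemma TC_TCall P n f : quadratic P ->
  rels (TC E P) n f -> rels (TCall E P) n f.
Proof.
move=> hP [MTf|]; first by left.
case=> t c D D' [r /hP rn /rn t2] c2 DC DC'; right.
exact: (@TCRel _ _ _ _ _ _ t c).
Qed.

Lemma TCall_TC P n f : ((1 < #|Omega|)%N -> every_tree_occurs P) ->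
  rels (TCall E P) n f -> rels (TC E P) n f \/ f = 0.
Proof.
move=> occP [MTf|]; first by left; left.
case=> t c D D' /andP[tn /eqP t2] c2 DC DC'.
have [O1|O1] := leqP #|Omega| 1; last first.
  by left; right; apply: (@TCRel _ _ _ _ _ _ t c) => //; apply: occP.
right; suff -> : D = D' by rewrite subrr.
move: DC DC'; rewrite !mem_Col => /andP[/eqP tD _] /andP[/eqP tD' _].
by apply: uncolour_inj; rewrite // tD.
Qed.

Lemma same_operad_trans (X Y : finType) (P1 P2 P3 : presentation k X Y) :
  same_operad P1 P2 -> same_operad P2 P3 -> same_operad P1 P3.
Proof.
move=> [s12 i12] [s23 i23]; split=> [x y|n p]; first by rewrite s12.
by rewrite i12.
Qed.

Lemma same_operad_TCall_TC P : quadratic P ->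
  ((1 < #|Omega|)%N -> every_tree_occurs P) ->
  same_operad (TCall E P) (TC E P).
Proof.
move=> hP occP; split=> // n f; split; apply: ideal_gen_le => // m p.
  by case/(TCall_TC occP) => [|->]; [apply: ideal_gen_rel | apply: ideal_gen0].
by move=> /(TC_TCall hP); apply: ideal_gen_rel.
Qed.

Lemma same_operad_dual_TC_TCall P : quadratic P ->
  ((1 < #|Omega|)%N -> every_tree_occurs P) ->
  same_operad (koszul_dual (TC E P)) (koszul_dual (TCall E P)).
Proof.
move=> hP occP; split=> // n f; split; apply: ideal_gen_le => // m p [pm pR].
  apply: ideal_gen_rel; split=> // r /(TCall_TC occP)[/pR //|-> s].
  by rewrite act0 pairing0r.
by apply: ideal_gen_rel; split=> // r /(TC_TCall hP)/pR.
Qed.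

End Listing.

End Polarization.

Theorem theorem3p2 (k : fieldType) (hk : [pchar k] =i pred0)
    (X1 X2 Omega : finType) (hOmega : (0 < #|Omega|)%N)
    (P : presentation k X1 X2) (hP : quadratic P)
    (E : {malg k[tree X1 X2]} -> {ffun Omega -> nat} -> tree X1 X2 ->
         seq (tree (Omega * X1)%type (Omega * X2)%type))
    (hE : is_listing E) :
  [/\ same_operad (koszul_dual (LC Omega P)) (TCall E (koszul_dual P)),
      same_operad (koszul_dual (TCall E P)) (LC Omega (koszul_dual P)),
      ((1 < #|Omega|)%N -> every_tree_occurs (koszul_dual P)) ->
        same_operad (koszul_dual (LC Omega P)) (TC E (koszul_dual P))
    & ((1 < #|Omega|)%N -> every_tree_occurs P) ->
        same_operad (koszul_dual (TC E P)) (LC Omega (koszul_dual P))].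
Proof.
have LCdual := koszul_dual_LC hE P; have TCdual := koszul_dual_TCall hE hk hP.
have hP' : quadratic (koszul_dual P) by move=> n r [].
split=> // occP.
  exact: same_operad_trans (same_operad_TCall_TC E hP' occP).
exact: same_operad_trans (same_operad_dual_TC_TCall E hP occP) TCdual.
Qed.
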